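(* Let $G$ be a locally compact group and let $\alpha$ be a (jointly continuous) action of $G$ on a locally compact Hausdorff space $M$; let $\alpha$ also denote the induced action on $A=C_\infty(M)$ given by $(\alpha_x f)(m)=f(\alpha_x^{-1}(m))$. Then the action $\alpha$ on the $C^*$-algebra $C_\infty(M)$ is proper (in the sense defined in the context) if and only if the action $\alpha$ on the space $M$ is proper, i.e. the map $M\times G\to M\times M$, $(m,x)\mapsto (m,\alpha_x(m))$, is proper (preimages of compact sets are compact).
   Context: $G$ carries a fixed left Haar measure $dx$. Let $\mathcal{B}$ be the set of $\lambda\in L^\infty(G)$ with compact support and $0\le\lambda\le 1$, directed by the pointwise order. For a strongly continuous action $\alpha$ of $G$ on a $C^*$-algebra $A$ and $\lambda\in\mathcal B$, $a\in A$, put $p_\lambda(a)=\int_G\lambda(x)\alpha_x(a)\,dx\in A$. An element $a\in A^+$ is called $\alpha$-proper if the net $(p_\lambda(a))_{\lambda\in\mathcal B}$ converges in the strict topology of the multiplier algebra $M(A)$ (a net $m_i\to m$ strictly iff $m_ia\to ma$ and $am_i\to am$ in norm for all $a\in A$). Let $\mathcal P_\alpha$ be the linear span of the $\alpha$-proper elements of $A^+$. The action $\alpha$ on $A$ is called proper if $\mathcal P_\alpha$ is dense in $A$. $C_\infty(M)$ denotes continuous functions vanishing at infinity. *)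

(* Defs.v *)
From HB Require Import structures.
From mathcomp Require Import all_boot all_order all_algebra.
From mathcomp Require Import all_classical all_reals all_analysis.
From mathcomp Require Import complex.
Import Order.TTheory GRing.Theory Num.Theory.
Import numFieldNormedType.Exports.
Set Implicit Arguments.
Unset Strict Implicit.
Unset Printing Implicit Defensive.
Local Open Scope classical_set_scope.
Local Open Scope ring_scope.

Definition Borel (T : ptopologicalType) := g_sigma_algebraType (@open T).

Notation cabs := (@Normc.normc _).

Definition is_lc_group (G : ptopologicalType) (mul : G -> G -> G)
    (inv : G -> G) (one : G) : Prop :=
  (forall x y z, mul x (mul y z) = mul (mul x y) z) /\
  (forall x, mul one x = x /\ mul x one = x) /\
  (forall x, mul (inv x) x = one /\ mul x (inv x) = one) /\
  continuous (fun p : G * G => mul p.1 p.2) /\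
  continuous inv /\
  hausdorff_space G /\
  locally_compact [set: G].

Definition is_left_Haar (R : realType) (G : ptopologicalType)
    (mul : G -> G -> G) (mu : {measure set (Borel G) -> \bar R}) : Prop :=
  [/\ (forall (x : G) (A : set (Borel G)), measurable A ->
          mu [set mul x a | a in A] = mu A),
      (forall K : set G, compact K -> (mu K < +oo)%E),
      (forall U : set G, open U -> U !=set0 -> (0 < mu U)%E),
      (forall A : set (Borel G), measurable A ->
          mu A = ereal_inf [set mu U | U in [set U : set G | open U /\ A `<=` U]]) &
      (forall U : set G, open U ->
          mu U = ereal_sup [set mu K | K in [set K : set G | compact K /\ K `<=` U]])].

Definition is_cont_action (G : ptopologicalType) (M : topologicalType)
    (mul : G -> G -> G) (one : G) (act : G -> M -> M) : Prop :=
  [/\ (forall m, act one m = m),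
      (forall x y m, act (mul x y) m = act x (act y m)) &
      continuous (fun p : G * M => act p.1 p.2)].

Definition proper_space_action (G : ptopologicalType) (M : topologicalType)
    (act : G -> M -> M) : Prop :=
  forall K : set (M * M)%type, compact K ->
    compact [set p : (M * G)%type | K (p.1, act p.2 p.1)].

Definition C0 (R : realType) (M : topologicalType) (f : M -> R[i]) : Prop :=
  continuous (fun m => (complex.Re (f m) : R)) /\ continuous (fun m => (complex.Im (f m) : R)) /\
  forall eps : R, 0 < eps ->
    exists K : set M, compact K /\ forall m, ~ K m -> cabs (f m) < eps.

Definition C0_pos (R : realType) (M : topologicalType) (f : M -> R[i]) : Prop :=
  C0 f /\ forall m, 0 <= f m.

(* The multiplier algebra M(C_oo(M)) realized as C_b(M). *)
Definition Cb (R : realType) (M : topologicalType) (h : M -> R[i]) : Prop :=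
  continuous (fun m => (complex.Re (h m) : R)) /\ continuous (fun m => (complex.Im (h m) : R)) /\
  exists c : R, forall m, cabs (h m) <= c.

(* The index set B: (representatives of) compactly supported L^oo      *)
(* functions with values in [0,1].                                     *)
Definition in_B (R : realType) (G : ptopologicalType) (lam : G -> R) : Prop :=
  measurable_fun [set: Borel G] (lam : Borel G -> R) /\
  (forall x, 0 <= lam x <= 1) /\
  exists K : set G, compact K /\ forall x, ~ K x -> lam x = 0.

(* p_lambda(f) = \int_G lambda(x) alpha_x(f) dx, evaluated at m,        *)
(* where (alpha_x f)(m) = f(alpha_{x^-1}(m)).                           *)
Definition p_lam (R : realType) (G : ptopologicalType) (M : topologicalType)
    (inv : G -> G) (act : G -> M -> M) (mu : {measure set (Borel G) -> \bar R})
    (lam : G -> R) (f : M -> R[i]) (m : M) : R[i] :=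
  complex.Complex (Rintegral mu [set: Borel G] (fun x : Borel G => lam x * complex.Re (f (act (inv x) m))))
  (Rintegral mu [set: Borel G] (fun x : Borel G => lam x * complex.Im (f (act (inv x) m)))).

(* alpha-proper elements: f in A^+ such that the net (p_lam f)_{lam in B} *)
(* (B directed by the pointwise order) converges strictly in M(A) = C_b(M):*)
(* there is h in C_b(M) with p_lam(f) g -> h g and g p_lam(f) -> g h in  *)
(* sup norm, for every g in A.                                           *)
Definition alpha_proper (R : realType) (G : ptopologicalType) (M : topologicalType)
    (inv : G -> G) (act : G -> M -> M) (mu : {measure set (Borel G) -> \bar R})
    (f : M -> R[i]) : Prop :=
  C0_pos f /\
  exists h : M -> R[i], Cb h /\
    forall g : M -> R[i], C0 g ->
      forall eps : R, 0 < eps ->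
        exists lam0 : G -> R, in_B lam0 /\
          forall lam : G -> R, in_B lam -> (forall x, lam0 x <= lam x) ->
            forall m,
              cabs (p_lam inv act mu lam f m * g m - h m * g m) <= eps /\
              cabs (g m * p_lam inv act mu lam f m - g m * h m) <= eps.

Definition proper_Cstar_action (R : realType) (G : ptopologicalType) (M : topologicalType)
    (inv : G -> G) (act : G -> M -> M) (mu : {measure set (Borel G) -> \bar R}) : Prop :=
  forall f : M -> R[i], C0 f ->
    forall eps : R, 0 < eps ->
      exists s : seq (R[i] * (M -> R[i])),
        (forall p, p \in s -> alpha_proper inv act mu p.2) /\
        forall m, cabs (f m - \sum_(p <- s) p.1 * p.2 m) <= eps.

(* Main.v *)
Require Import Defs.
From HB Require Import structures.
From mathcomp Require Import all_boot all_order all_algebra.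
From mathcomp Require Import all_classical all_reals all_analysis.
From mathcomp Require Import measurable_realfun complex.
From mathcomp Require Import ring lra.
Import Order.TTheory GRing.Theory Num.Theory.
Import numFieldNormedType.Exports.
Set Implicit Arguments.
Unset Strict Implicit.
Unset Printing Implicit Defensive.
Local Open Scope classical_set_scope.
Local Open Scope ring_scope.

(* If the action on [M] is proper and [f >= 0] is continuous with compact support
   [K], then on a compact set [L] the functions [p_lam f] agree with
   [h m = \int f (x^-1 m) dx] as soon as [lam = 1] on the compact set of the [x]
   with [x^-1 L] meeting [K]; [h] is bounded because it is constant on orbits and
   vanishes on those avoiding [K].  Truncations [max (u - e) 0] of real and
   imaginary parts show that the span of such [f] is dense.

   Conversely, density provides near any [m0], [n0] proper elements [f], [g] with
   [f m0 > 0], [g n0 > 0].  Strict convergence makes [\int_E f (y^-1 n) dy]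
   uniformly small where [g] is bounded below, for [E] outside a compact set [D].
   If [f m >= 2 c], uniform continuity of translation gives [f (y^-1 (x m)) >= c]
   for [y] in [x V], a set of mass independent of [x]; so [x V] meets [D] whenever
   [m] is close to [m0] and [x m] close to [n0].  Compactness of [K] in [M * M]
   globalizes this. *)

(** * Integrals controlled by a set of finite measure *)

Section integral_bounds.
Context d (T : measurableType d) (R : realType) (mu : {measure set T -> \bar R}).

Lemma integrable_cst_indic (D : set T) (c : R) : measurable D ->
  (mu D < +oo)%E -> mu.-integrable setT (EFin \o (fun x => c * \1_D x)).
Proof.
move=> mD muD; rewrite (_ : _ \o _ = (fun x => (c%:E * (\1_D x)%:E)%E))//.
apply: integrableZl => //; apply/integrableP; split.
  by apply/measurable_EFinP; exact: measurable_indic.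
rewrite (eq_integral (EFin \o \1_D)) ?integral_indic ?setIT//.
by move=> x _ /=; rewrite ger0_norm.
Qed.

Lemma Rintegral_cst_indic (D : set T) (c : R) : measurable D ->
  (mu D < +oo)%E -> \int[mu]_x (c * \1_D x) = c * fine (mu D).
Proof.
move=> mD muD.
have i1 : mu.-integrable setT (EFin \o \1_D).
  have := integrable_cst_indic 1 mD muD.
  by apply: eq_integrable => //= x _; rewrite mul1r.
by rewrite RintegralZl// /Rintegral integral_indic// setIT.
Qed.

Lemma integrable_bounded_support (D : set T) (f : T -> R) (c : R) :
  measurable D -> (mu D < +oo)%E -> measurable_fun setT f ->
  (forall x, `|f x| <= c) -> (forall x, ~ D x -> f x = 0) ->
  mu.-integrable setT (EFin \o f).
Proof.
move=> mD muD mf fc f0.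
apply: (le_integrable _ _ _ (integrable_cst_indic c mD muD)) => //=.
  exact/measurable_EFinP.
move=> x _; rewrite lee_fin indicE; case: (boolP (x \in D)) => [_|].
  by rewrite mulr1 (le_trans (fc x))// ler_norm.
by rewrite notin_setE => /f0 ->; rewrite normr0.
Qed.

Lemma Rintegral_bounded_support (D : set T) (f : T -> R) (c : R) :
  measurable D -> (mu D < +oo)%E -> measurable_fun setT f ->
  (forall x, `|f x| <= c) -> (forall x, ~ D x -> f x = 0) ->
  `|\int[mu]_x f x| <= c * fine (mu D).
Proof.
move=> mD muD mf fc f0.
have intf := integrable_bounded_support mD muD mf fc f0.
rewrite (le_trans (le_normr_Rintegral _ intf))// -Rintegral_cst_indic//.
apply: le_Rintegral => //; first exact: integrable_abse intf.
  exact: integrable_cst_indic.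
move=> x _; rewrite indicE; case: (boolP (x \in D)) => [_|].
  by rewrite mulr1.
by rewrite notin_setE => /f0 ->; rewrite normr0 mulr0.
Qed.

Lemma Rintegral_ge_cst (D : set T) (f : T -> R) (c : R) :
  measurable D -> (mu D < +oo)%E -> mu.-integrable setT (EFin \o f) ->
  (forall x, 0 <= f x) -> (forall x, D x -> c <= f x) ->
  c * fine (mu D) <= \int[mu]_x f x.
Proof.
move=> mD muD intf f0 fc; rewrite -Rintegral_cst_indic//.
apply: le_Rintegral => //; first exact: integrable_cst_indic.
move=> x _; rewrite indicE; case: (boolP (x \in D)) => [|_].
  by rewrite inE mulr1; exact: fc.
by rewrite mulr0.
Qed.

End integral_bounds.

(** * Borel measurability, products and compactness *)

Section topology.

Lemma continuous_Borel_measurable (R : realType) (T : ptopologicalType)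
    (f : T -> R) : continuous f -> measurable_fun [set: Borel T] (f : Borel T -> R).
Proof.
move=> /continuousP cf; apply: (measurability _ (RGenOpens.measurableE R)).
move=> _ [_ [a [b ->] <-]]; rewrite setTI; apply: sub_sigma_algebra.
by apply: cf; exact: interval_open.
Qed.

Lemma closed_Borel_measurable (T : ptopologicalType) (A : set T) :
  closed A -> measurable (A : set (Borel T)).
Proof.
move=> cA; rewrite -[A]setCK; apply: measurableC; apply: sub_sigma_algebra.
exact: closed_openC.
Qed.

Lemma hausdorff_prod (S T : topologicalType) :
  hausdorff_space S -> hausdorff_space T -> hausdorff_space (S * T)%type.
Proof.
move=> hS hT [p1 p2] [q1 q2] pq; congr pair.
- apply: hS => A B nA nB.
  have [||[x y] [/= [? _] [? _]]] := pq (A `*` setT) (B `*` setT).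
  + by exists (A, setT) => //=; split => //; exact: filterT.
  + by exists (B, setT) => //=; split => //; exact: filterT.
  by exists x.
- apply: hT => A B nA nB.
  have [||[x y] [/= [_ ?] [_ ?]]] := pq (setT `*` A) (setT `*` B).
  + by exists (setT, A) => //=; split => //; exact: filterT.
  + by exists (setT, B) => //=; split => //; exact: filterT.
  by exists y.
Qed.

(** Each [t] in [K] has a product neighbourhood on which [F] stays within [eps / 2] of [F s0 t]; the
    near-covering form of compactness makes one neighbourhood of [s0] serve all of [K]. *)
Lemma compact_unif_continuous (R : realType) (S T : topologicalType)
    (K : set T) (F : S -> T -> R) (s0 : S) (eps : R) :
  compact K -> continuous (fun p : S * T => F p.1 p.2) -> 0 < eps ->
  \forall s \near s0, forall t, K t -> `|F s t - F s0 t| < eps.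
Proof.
move=> /compact_near_coveringP cK cF e0.
apply: (cK S (nbhs s0) (fun s t => `|F s t - F s0 t| < eps)) => t Kt.
have e2 : 0 < eps / 2 by rewrite divr_gt0.
have /cvgrPdist_lt/(_ _ e2) [[A B] /= [nA nB] AB] := cF (s0, t).
exists (B, A) => //= -[t' s] /= [Bt' As].
have h1 := AB (s, t') (conj As Bt').
have h2 := AB (s0, t') (conj (nbhs_singleton nA) Bt').
rewrite /= in h1 h2; move: h1 h2; rewrite !ltr_norml => /andP[? ?] /andP[? ?].
by apply/andP; split; lra.
Qed.

End topology.

(** * The modulus on [R[i]] against real and imaginary parts *)

Section complex_modulus.
Context (R : realType).
Implicit Types z : R[i].

Lemma normc_ge_Re z : `|complex.Re z| <= cabs z.
Proof.
case: z => a b /=; rewrite -sqrtr_sqr; apply: ler_wsqrtr.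
by rewrite lerDl sqr_ge0.
Qed.

Lemma normc_real z : complex.Im z = 0 -> cabs z = `|complex.Re z|.
Proof. by case: z => a b /= ->; rewrite expr0n addr0 sqrtr_sqr. Qed.

Lemma normc_le_ReIm z : cabs z <= `|complex.Re z| + `|complex.Im z|.
Proof.
case: z => a b /=.
rewrite -[leRHS]ger0_norm ?addr_ge0// -sqrtr_sqr; apply: ler_wsqrtr.
rewrite -(real_normK (num_real a)) -(real_normK (num_real b)).
have := normr_ge0 a; have := normr_ge0 b; nra.
Qed.

Lemma ge0_ImE z : 0 <= z -> complex.Im z = 0.
Proof. by rewrite lecE => /andP[/eqP]. Qed.

Lemma ge0_Re z : 0 <= z -> 0 <= complex.Re z.
Proof. by rewrite lecE => /andP[]. Qed.

End complex_modulus.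

(** * Bounds and bump functions in [C0] *)

Section C0_functions.
Context (R : realType) (M : topologicalType).

Lemma compact_bound (K : set M) (F : M -> R) : compact K -> continuous F ->
  exists2 c, 0 <= c & forall m, K m -> `|F m| <= c.
Proof.
move=> cK cF.
have /compact_bounded/pinfty_ex_gt0[c c0 hc] : compact (F @` K).
  by apply: continuous_compact => //; exact: continuous_subspaceT.
by exists c => [|m Km]; [exact: ltW|apply: hc; exists m].
Qed.

Lemma C0_Re_bounded (f : M -> R[i]) : C0 f ->
  exists2 c, 0 <= c & forall m, `|complex.Re (f m)| <= c.
Proof.
move=> [cR [_ /(_ 1 ltr01)[K [cK K1]]]].
have [c c0 hc] := compact_bound cK cR.
exists (c + 1) => [|m]; first by rewrite addr_ge0.
have [Km|/K1 f1] := pselect (K m); first by rewrite (le_trans (hc m Km))// lerDl.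
by rewrite (le_trans (normc_ge_Re _))// (le_trans (ltW f1))// lerDr.
Qed.

(** Complete regularity separates [m] from the complement of the interior of a compact neighbourhood
    [U]; one minus the separating function vanishes off [U]. *)
Lemma C0_bump (m : M) : hausdorff_space M -> locally_compact [set: M] ->
  exists2 f : M -> R[i], C0 f & f m = 1.
Proof.
move=> hM lM; have [U + [cU clU]] := lM m I.
rewrite withinET => nU.
have [||phi [cphi _ phi0 phi1]] := iffLR (@uniform_separatorP _ R _ _)
    (locally_compact_completely_regular (R := R) lM hM (a := m)
      (B := ~` interior U) _ _).
- exact/open_closedC/open_interior.
- by move=> /(_ nU).
exists (fun x => (1 - phi x)%:C%C); last first.
  have -> : phi m = 0 by apply: phi0; exists m.
  by rewrite subr0.
split=> [x /=|]; first by apply: cvgB; [exact: cvg_cst|exact: cphi].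
split=> [x /=|eps e0]; first exact: cvg_cst.
exists U; split=> // x Ux /=.
have -> : phi x = 1 by apply: phi1; exists x => // /interior_subset.
by rewrite subrr expr0n addr0 sqrtr0.
Qed.

End C0_functions.

(** * Orbit functions, and properness passing from the algebra to the space *)

Section action.
Context (R : realType) (G : ptopologicalType) (M : topologicalType)
  (mul : G -> G -> G) (inv : G -> G) (one : G)
  (mu : {measure set (Borel G) -> \bar R}) (act : G -> M -> M).
Context (hG : is_lc_group mul inv one) (hmu : is_left_Haar mul mu)
  (hM : hausdorff_space M) (lM : locally_compact [set: M])
  (hact : is_cont_action mul one act).

Let mulA x y z : mul x (mul y z) = mul (mul x y) z.
Proof. by case: hG. Qed.

Let mul1g x : mul one x = x.
Proof. by case: hG => _ [/(_ x)[]]. Qed.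

Let mulg1 x : mul x one = x.
Proof. by case: hG => _ [/(_ x)[]]. Qed.

Let mulVg x : mul (inv x) x = one.
Proof. by case: hG => _ [_ [/(_ x)[]]]. Qed.

Let mulgV x : mul x (inv x) = one.
Proof. by case: hG => _ [_ [/(_ x)[]]]. Qed.

Let mul_cont : continuous (fun p : G * G => mul p.1 p.2).
Proof. by case: hG => _ [_ [_ []]]. Qed.

Let inv_cont : continuous inv.
Proof. by case: hG => _ [_ [_ [_ []]]]. Qed.

Let hausG : hausdorff_space G.
Proof. by case: hG => _ [_ [_ [_ [_ []]]]]. Qed.

Let lcG : locally_compact [set: G].
Proof. by case: hG => _ [_ [_ [_ [_ []]]]]. Qed.

Let act_cont : continuous (fun p : G * M => act p.1 p.2).
Proof. by case: hact. Qed.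

Let act1 m : act one m = m.
Proof. by case: hact. Qed.

Let actM x y m : act (mul x y) m = act x (act y m).
Proof. by case: hact. Qed.

Let actKV x m : act x (act (inv x) m) = m.
Proof. by rewrite -actM mulgV. Qed.

Let actVK x m : act (inv x) (act x m) = m.
Proof. by rewrite -actM mulVg. Qed.

Let invK x : inv (inv x) = x.
Proof. by rewrite -[LHS]mulg1 -(mulVg x) mulA mulVg mul1g. Qed.

Let inv1 : inv one = one.
Proof. by rewrite -[LHS]mulg1 mulVg. Qed.

Let invM x y : inv (mul x y) = mul (inv y) (inv x).
Proof.
have xy1 : mul (mul x y) (mul (inv y) (inv x)) = one.
  by rewrite -mulA (mulA y) mulgV mul1g mulgV.
by rewrite -[LHS]mulg1 -xy1 mulA mulVg mul1g.
Qed.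

Let mulK_cont x : continuous (mul x).
Proof.
by move=> y; apply: (cvg_comp2 (cvg_cst _) cvg_id (@mul_cont (_, _))).
Qed.

Let orbit_cont (F : M -> R) m : continuous F ->
  continuous (fun x => F (act (inv x) m)).
Proof.
move=> cF x; apply: cvg_comp; last exact: cF.
by apply: (cvg_comp2 (@inv_cont x) (cvg_cst _) (@act_cont (_, _))).
Qed.

Let compact_measurable (K : set G) : compact K -> measurable (K : set (Borel G)).
Proof. by move=> cK; apply: closed_Borel_measurable; exact: compact_closed. Qed.

Let open_measurable (U : set G) : open U -> measurable (U : set (Borel G)).
Proof. exact: sub_sigma_algebra. Qed.

Let compact_fin (K : set G) : compact K -> (mu K < +oo)%E.
Proof. by case: hmu => _ + _ _ _; exact. Qed.

(** Off a large compact set [K] the values are small, so only pairs meeting [K] matter, and there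
    uniform continuity near [one] applies. *)
Lemma translation_continuity (f : M -> R[i]) (c : R) : C0 f -> 0 < c ->
  \forall v \near one, forall m,
    `|complex.Re (f (act (inv v) m)) - complex.Re (f m)| <= c.
Proof.
move=> [cR [_ f0]] c0.
have [|K [cK fK]] := f0 (c / 2); first by rewrite divr_gt0.
pose F s t : R := complex.Re (f (act s t)).
have cF : continuous (fun p : G * M => F p.1 p.2).
  by move=> p; apply: (cvg_comp _ _ (@act_cont p) (cR _)).
have nW := compact_unif_continuous one cK cF c0.
have nWV : \forall v \near one, forall t, K t -> `|F (inv v) t - F one t| < c.
  have : inv @ one --> one by rewrite -{2}inv1; exact: inv_cont.
  by move=> /(_ _ nW).
near=> v => m.
have Wv : forall t, K t -> `|F v t - F one t| < c by near: v.
have WVv : forall t, K t -> `|F (inv v) t - F one t| < c by near: v.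
have [Km|/fK Km] := pselect (K m).
  by apply: ltW; have := WVv _ Km; rewrite /F act1.
(* When only the translate lies in [K], one moves back from it by [v]; hence both [v] and [inv v]
   are kept near [one]. *)
have [Km'|/fK Km'] := pselect (K (act (inv v) m)).
  by rewrite distrC; apply: ltW; have := Wv _ Km'; rewrite /F act1 actKV.
rewrite (le_trans (ler_normB _ _))// [c]splitr lerD//; apply: ltW.
  exact: le_lt_trans (normc_ge_Re _) Km'.
exact: le_lt_trans (normc_ge_Re _) Km.
Unshelve. all: by end_near. Qed.
(** The integrand is bounded and vanishes off a compact set, which has finite Haar mass; this gives
    access to linearity of the integrals in [p_lam]. *)
Lemma integrable_orbit (lam : G -> R) (f : M -> R[i]) (m : M) :
  in_B lam -> C0 f ->
  mu.-integrable [set: Borel G]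
    (EFin \o (fun x => lam x * complex.Re (f (act (inv x) m)))).
Proof.
move=> [mlam [lam01 [K [cK lamK]]]] f0; have [c c0 fc] := C0_Re_bounded f0.
case: f0 => cR _.
apply: (@integrable_bounded_support _ _ _ mu K _ c).
- exact: compact_measurable.
- exact: compact_fin.
- apply: measurable_funM => //; apply: continuous_Borel_measurable.
  exact: (orbit_cont cR).
- move=> x; rewrite normrM (le_trans _ (fc (act (inv x) m)))// ler_piMl//; have /andP[l0 l1] := lam01 x.
  by rewrite ger0_norm.
- by move=> x /lamK ->; rewrite mul0r.
Qed.

(* Left Haar invariance gives every translate x V the same mass, so that mass
   located outside the support of a large [lam0] contradicts strict
   convergence. *)
Lemma alpha_proper_escape (f g : M -> R[i]) (c d : R) :
  alpha_proper inv act mu f -> C0 g -> 0 < c -> 0 < d ->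
  exists2 C : set G, compact C & forall x, ~ C x -> forall m,
    2 * c < complex.Re (f m) -> d < complex.Re (g (act x m)) -> False.
Proof.
move=> [[f0 fge0] [h [_ hlim]]] g0 c_gt0 d_gt0.
have nV := translation_continuity f0 c_gt0.
have [U + [cU _]] := @lcG one I; rewrite withinET => nU.
(* Intersecting with the compact [U] keeps the mass finite; the interior is an open neighbourhood of
   [one], hence of positive mass. *)
pose V := interior (U `&` [set v | forall m,
    `|complex.Re (f (act (inv v) m)) - complex.Re (f m)| <= c]).
have VU v : V v -> U v by move=> /interior_subset[].
have Vf v : V v -> forall m,
    `|complex.Re (f (act (inv v) m)) - complex.Re (f m)| <= c.
  by move=> /interior_subset[].
have oV : open V by exact: open_interior.
have muV_fin : (mu V < +oo)%E.
  apply: le_lt_trans (compact_fin cU); apply: le_measure => //; rewrite inE.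
    exact: open_measurable.
  exact: compact_measurable.
have muV0 : 0 < fine (mu V).
  apply: fine_gt0; rewrite muV_fin andbT; case: hmu => _ _ + _ _; apply => //.
  by exists one; rewrite /V/= /interior; exact: filterI.
(* The estimates for [lam] and [lam0] add up to [2 * eps], half of the lower bound
   [c * fine (mu V) * d] reached at the end. *)
pose eps := c * fine (mu V) * d / 4.
have eps0 : 0 < eps by rewrite /eps !(divr_gt0, mulr_gt0).
have [lam0 [Blam0 lam0P]] := hlim g g0 eps eps0.
have [mlam0 [lam001 [D [cD lam0D]]]] := Blam0.
(* For [x] outside [D U^-1] the translate [x U], and so [x V], misses [D], off which [lam0]
   vanishes. *)
exists [set mul p.1 (inv p.2) | p in D `*` U].
  apply: continuous_compact; last exact: compact_setX.
  apply: continuous_subspaceT => -[y z].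
  have h2 : inv p.2 @[p --> (y, z)] --> inv z.
    by apply: (@cvg_comp _ _ _ snd inv _ (nbhs z)); [exact: cvg_snd|exact: inv_cont].
  apply: (@cvg_comp2 _ _ _ _ (nbhs (y, z)) (nbhs y) (nbhs (inv z)) _ _ _ _ fst
    (fun p => inv p.2) mul); [exact: cvg_fst|exact: h2|].
  exact: (@mul_cont (y, inv z)).
move=> x nCx m fm gm.
pose E := [set mul x v | v in V].
have EE : E = mul (inv x) @^-1` V.
  apply/seteqP; split=> [_ [v Vv <-] /=|y /= Vy]; first by rewrite mulA mulVg mul1g.
  by exists (mul (inv x) y); rewrite // mulA mulgV mul1g.
have oE : open E by rewrite EE; apply: open_comp.
have mE : measurable (E : set (Borel G)) by exact: open_measurable.
have muE : mu E = mu V.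
  by case: hmu => + _ _ _ _; apply; exact: open_measurable.
have ED y : E y -> ~ D y.
  move=> [v Vv <-] Dxv; apply: nCx; exists (mul x v, v) => /=.
    by split => //=; exact: VU.
  by rewrite -mulA mulgV mulg1.
(* Adding the indicator of [E] keeps values at most 1 because [lam0] is zero on [E]; the two orbit
   integrals then differ exactly by the integral over [E]. *)
pose lam y := lam0 y + \1_E y : R.
have Blam : in_B lam.
  split; first by apply: measurable_funD => //; exact: measurable_indic.
  split=> [y|].
    rewrite /lam indicE; case: (boolP (y \in E)) => [|_].
      by rewrite inE => /ED /lam0D ->; rewrite add0r ler01 lexx.
    by rewrite addr0.
  exists (D `|` [set mul x u | u in U]); split.
    apply: compactU => //; apply: continuous_compact => //.
    exact/continuous_subspaceT/mulK_cont.
  move=> y nDy; rewrite /lam indicE lam0D; last by move=> Dy; apply: nDy; left.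
  rewrite memNset ?addr0//.
  by move=> [v Vv xv]; apply: nDy; right; exists v => //; exact: VU.
have lam0_le y : lam0 y <= lam y by rewrite /lam lerDl.
pose n := act x m.
have [H1 _] := lam0P lam Blam lam0_le n.
have [H0 _] := lam0P lam0 Blam0 (fun=> lexx _) n.
pose q (l : G -> R) := \int[mu]_y (l y * complex.Re (f (act (inv y) n))).
have qE : q lam - q lam0 = \int[mu]_y (\1_E y * complex.Re (f (act (inv y) n))).
  rewrite -RintegralB//; try exact: integrable_orbit.
  by apply: eq_Rintegral => y _; rewrite -mulrBl /lam addrAC subrr add0r.
have q_ge : c * fine (mu V) <= q lam - q lam0.
  rewrite qE -muE; apply: Rintegral_ge_cst => //; first by rewrite muE.
  - have := integrableB _ (integrable_orbit n Blam f0) (integrable_orbit n Blam0 f0).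
    move=> /(_ measurableT); apply: eq_integrable => // y _ /=.
    by rewrite -EFinB -mulrBl /lam addrAC subrr add0r.
  - by move=> y; rewrite mulr_ge0//; exact: ge0_Re.
  (* For [y = x v] one has [y^-1 n = v^-1 m], where [f] loses at most [c] from a value above
     [2 * c]. *)
  - move=> y Ey; rewrite indicE mem_set// mul1r.
    case: Ey => v Vv <-; rewrite invM actM /n actVK.
    have := Vf _ Vv m; rewrite ler_norml => /andP[+ _]; lra.
have : (q lam - q lam0) * d <= 2 * eps.
  set pl := p_lam inv act mu lam f n in H1.
  set p0 := p_lam inv act mu lam0 f n in H0.
  have -> : q lam - q lam0 = complex.Re (pl - p0) by [].
  apply: (@le_trans _ _ (cabs ((pl - p0) * g n))).
    rewrite Normc.normcM; apply: ler_pM => //.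
    - by apply: le_trans q_ge; rewrite mulr_ge0 // ltW.
    - exact: ltW.
    - exact: le_trans (ler_norm _) (normc_ge_Re _).
    - exact: le_trans (ltW gm) (le_trans (ler_norm _) (normc_ge_Re _)).
  (* The unknown limit [h] cancels between the two estimates. *)
  have -> : (pl - p0) * g n = (pl * g n - h n * g n) + - (p0 * g n - h n * g n).
    by rewrite !mulrBl opprB addrA subrK.
  by rewrite (le_trans (le_normcD _ _))// normcN mulr2n mulrDl mul1r lerD.
have : c * fine (mu V) * d <= (q lam - q lam0) * d by rewrite ler_wpM2r// ltW.
have : 0 < c * fine (mu V) * d by rewrite !mulr_gt0.
by rewrite /eps; lra.
Qed.

(** If every proper element vanished at [m], so would every combination of them, and none could come
    within [1 / 2] of a bump equal to 1 at [m]. *)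
Lemma exists_alpha_proper_gt0 (m : M) : proper_Cstar_action inv act mu ->
  exists2 f, alpha_proper inv act mu f & 0 < complex.Re (f m).
Proof.
move=> dense; have [f0 Cf0 f0m] := C0_bump R m hM lM.
have [|s [sP sE]] := dense f0 Cf0 (1 / 2); first by rewrite divr_gt0.
apply: contrapT => noproper.
have s0 p : p \in s -> p.2 m = 0.
  move=> /[dup] ps /sP pp; have [[_ /(_ m) p0] _] := pp.
  have : complex.Re (p.2 m) = 0.
    apply/eqP; rewrite eq_le ge0_Re// andbT leNgt; apply/negP => pgt0.
    by apply: noproper; exists p.2.
  by move: (ge0_ImE p0); case: (p.2 m) => a b /= -> ->.
have := sE m; rewrite f0m big_seq big1; last by move=> p /s0 ->; rewrite mulr0.
by rewrite subr0 Normc.normc1; lra.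
Qed.

Lemma proper_Cstar_space : proper_Cstar_action inv act mu ->
  proper_space_action act.
Proof.
move=> dense K cK.
(* Being near along [F] means lying outside some compact subset of [G]; the near-covering property
   merges the local sets [C] into one valid for all of [K]. *)
pose F := filter_from (@compact G) setC.
have FF : Filter F.
  apply: filter_from_filter; first by exists set0; exact: compact0.
  move=> C C' cC cC'; exists (C `|` C'); first exact: compactU.
  by rewrite setCU.
have [C cC CK] : \forall x \near F, K `<=` (fun p => act x p.1 <> p.2).
  move/compact_near_coveringP : (cK); apply => -[m0 n0] _.
  have [f pf fm0] := exists_alpha_proper_gt0 m0 dense.
  have [g pg gn0] := exists_alpha_proper_gt0 n0 dense.
  have [[Cf _] _] := pf.1; have [[Cg _] _] := pg.1.
  (* Here [2 * c] and [d] are half the values at [m0] and [n0], so both strict inequalities persist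
     nearby. *)
  pose c := complex.Re (f m0) / 4; pose d := complex.Re (g n0) / 2.
  have c0 : 0 < c by rewrite divr_gt0.
  have d0 : 0 < d by rewrite divr_gt0.
  have [C cC CP] := alpha_proper_escape pf (pg.1).1 c0 d0.
  have nf : \forall m \near m0, 2 * c < complex.Re (f m).
    by apply: (cvgr_gt _ (Cf m0)); rewrite /c; lra.
  have ng : \forall n \near n0, d < complex.Re (g n).
    by apply: (cvgr_gt _ (Cg n0)); rewrite /d; lra.
  exists ([set m | 2 * c < complex.Re (f m)] `*` [set n | d < complex.Re (g n)], ~` C).
    split; last by exists C.
    by exists ([set m | 2 * c < complex.Re (f m)], [set n | d < complex.Re (g n)]).
  move=> [[m n] x] /= [[fm gn] nCx] xm; apply: (CP x nCx m fm).
  by rewrite xm.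
have clK : closed K by apply: compact_closed => //; exact: hausdorff_prod.
(* The preimage of the closed set [K] is closed, and it lies in the product of the first projection
   of [K] with [C]. *)
apply: (@subclosed_compact _ _ ((fst @` K) `*` C)).
- apply: (@closed_comp _ _ (fun p : M * G => (p.1, act p.2 p.1))) => // -[a b] _.
  apply: cvg_pair; first exact: cvg_fst.
  apply: (@cvg_comp _ _ _ (fun p : M * G => (p.2, p.1)) (fun q => act q.1 q.2)
    _ (nbhs (b, a))).
    by apply: cvg_pair; [exact: cvg_snd|exact: cvg_fst].
  exact: (@act_cont (b, a)).
- apply: compact_setX => //; apply: continuous_compact => //.
  by apply: continuous_subspaceT => -[a b]; exact: cvg_fst.
- move=> [m x] /= Kp; split => /=; first by exists (m, act x m).
  by apply: contrapT => nCx; exact: (CK x nCx _ Kp).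
Qed.

(** * Properness passing from the space to the algebra *)

Section proper_space.
Context (pact : proper_space_action act).

(** Properness makes the preimage of the product of [L] and [K] compact; it is projected to [G] and
    inverted, since the points tested are [act (inv x) m]. *)
Lemma compact_return (L K : set M) : compact L -> compact K ->
  exists2 D : set G, compact D &
    forall x m, L m -> K (act (inv x) m) -> D x.
Proof.
move=> cL cK; have cLK := pact (compact_setX cL cK).
exists ((inv \o snd) @` [set p : M * G | (L `*` K) (p.1, act p.2 p.1)]).
  apply: continuous_compact => //; apply: continuous_subspaceT => -[a b].
  by apply: (@cvg_comp _ _ _ snd inv _ (nbhs b)); [exact: cvg_snd|exact: inv_cont].
by move=> x m Lm Km; exists (m, inv x) => //=; rewrite invK.
Qed.

Section compact_support.
Context (f : M -> R) (K : set M) (cf : continuous f) (f_ge0 : forall m, 0 <= f m)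
  (cK : compact K) (fK : forall m, ~ K m -> f m = 0).

Let orbit_measurable (m : M) (w : Borel G -> R) :
  measurable_fun [set: Borel G] w ->
  measurable_fun [set: Borel G] (fun x : Borel G => w x * f (act (inv x) m)).
Proof.
move=> mw; apply: measurable_funM => //; apply: continuous_Borel_measurable.
exact: orbit_cont.
Qed.

Let orbit_support (L : set M) : compact L -> exists2 D : set G, compact D &
  forall x m, L m -> ~ D x -> f (act (inv x) m) = 0.
Proof.
move=> cL; have [D cD DP] := compact_return cL cK; exists D => // x m Lm nDx.
by apply: fK => Km; apply: nDx; exact: DP Km.
Qed.

(* Points whose orbit meets [K] have, up to a left translation, the same return
   set to [K] as a point of [K]: hence a bound independent of [m]. *)
Lemma orbit_integral_bounded : exists2 b, 0 <= b &
  forall m (w : Borel G -> R), measurable_fun [set: Borel G] w ->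
    (forall x, `|w x| <= 1) ->
    mu.-integrable [set: Borel G] (EFin \o (fun x => w x * f (act (inv x) m))) /\
    `|\int[mu]_x (w x * f (act (inv x) m))| <= b.
Proof.
have [c c0 fc] := compact_bound cK cf.
have {}fc m : `|f m| <= c.
  by have [/fc//|/fK ->] := pselect (K m); rewrite normr0.
have [D cD DP] := compact_return cK cK.
exists (c * fine (mu D)); first by rewrite mulr_ge0// fine_ge0.
move=> m w mw w1.
have [[x0 Kx0]|noK] := pselect (exists x0, K (act (inv x0) m)); last first.
  have -> : (fun x => w x * f (act (inv x) m)) = cst 0.
    by apply/funext => x /=; rewrite fK ?mulr0// => Kx; apply: noK; exists x.
  split; first exact: integrable0.
  by rewrite Rintegral_cst// mul0r normr0 mulr_ge0// fine_ge0.
(* If [act (inv x0) m] and [act (inv x) m] both lie in [K], then [mul (inv x0) x] is in [D]; so [E]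
   carries the integrand, and left invariance gives it the mass of [D]. *)
pose E := [set mul x0 y | y in D].
have cE : compact E.
  by apply: continuous_compact => //; exact/continuous_subspaceT/mulK_cont.
have mE := compact_measurable cE.
have muE : mu E = mu D by case: hmu => + _ _ _ _; apply; exact: compact_measurable.
have Efin : (mu E < +oo)%E by exact: compact_fin.
have wfc x : `|w x * f (act (inv x) m)| <= c.
  by rewrite normrM (le_trans _ (fc (act (inv x) m)))// ler_piMl.
have E0 x : ~ E x -> w x * f (act (inv x) m) = 0.
  move=> nEx; rewrite fK ?mulr0// => Kx; apply: nEx.
  exists (mul (inv x0) x); last by rewrite mulA mulgV mul1g.
  by apply: DP Kx0 _; rewrite invM invK actM actKV.
have mwf := orbit_measurable m mw.
split; first exact: (integrable_bounded_support mE Efin mwf wfc E0).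
by rewrite -muE; exact: (Rintegral_bounded_support mE Efin mwf wfc E0).
Qed.

Let h m : R := \int[mu]_x f (act (inv x) m).

(** For [m] near [m0] all integrands vanish off one compact [D], on which they are uniformly close;
    the finite mass of [D] concludes. *)
Lemma orbit_integral_continuous : continuous h.
Proof.
move=> m0; have [U + [cU _]] := @lM m0 I; rewrite withinET => nU.
have [D cD D0] := orbit_support cU.
have [b b0 fb] := orbit_integral_bounded.
have intf m : mu.-integrable [set: Borel G] (EFin \o (fun x => f (act (inv x) m))).
  have [|i _] := fb m (cst 1) (@measurable_cst _ _ _ _ _ _).
    by move=> x; rewrite normr1.
  by apply: eq_integrable i => // x _ /=; rewrite mul1r.
apply/cvgrPdist_lt => eps eps0.
(* The added 1 allows for a [D] of mass zero and keeps the final inequality strict. *)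
pose e := eps / (fine (mu D) + 1).
have muD0 : 0 <= fine (mu D) by exact: fine_ge0.
have e0 : 0 < e by rewrite divr_gt0// ltr_pwDr.
pose F m x := f (act (inv x) m).
have cF : continuous (fun p : M * G => F p.1 p.2).
  move=> [m x]; apply: (@cvg_comp _ _ _ (fun p : M * G => act (inv p.2) p.1) f
    _ (nbhs (act (inv x) m))); last exact: cf.
  apply: (@cvg_comp _ _ _ (fun p : M * G => (inv p.2, p.1)) (fun q => act q.1 q.2)
    _ (nbhs (inv x, m))); last exact: (@act_cont (inv x, m)).
  apply: cvg_pair; last exact: cvg_fst.
  by apply: (@cvg_comp _ _ _ snd inv _ (nbhs x)); [exact: cvg_snd|exact: inv_cont].
have nF := compact_unif_continuous m0 cD cF e0.
near=> m.
have Um : U m by near: m.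
have Fm : forall x, D x -> `|F m x - F m0 x| < e by near: m.
rewrite distrC /h -RintegralB//.
apply: (@le_lt_trans _ _ (e * fine (mu D))); last first.
  rewrite /e mulrAC ltr_pdivrMr ?ltr_pwDr// mulrDr mulr1 ltrDl//.
have D0m x : ~ D x -> f (act (inv x) m) - f (act (inv x) m0) = 0.
  by move=> nDx; rewrite !D0 ?subrr//; exact: nbhs_singleton.
apply: (@Rintegral_bounded_support _ _ _ mu D) => //.
- exact: compact_measurable.
- exact: compact_fin.
- by apply: measurable_funB; apply: continuous_Borel_measurable; exact: orbit_cont.
- move=> x; have [Dx|nDx] := pselect (D x); first exact: ltW (Fm x Dx).
  by rewrite !D0 ?subrr ?normr0 ?(ltW e0)//; exact: nbhs_singleton.
Unshelve. all: by end_near. Qed.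

(** The strict limit is [h]: on a compact [L] the difference vanishes for large [lam], and off [L]
    the factor [g] is small while the difference stays bounded by [b]. *)
Lemma compact_support_alpha_proper :
  alpha_proper inv act mu (fun m => (f m)%:C%C).
Proof.
have f0 : C0 (fun m => (f m)%:C%C).
  split; first exact: cf.
  split=> [x /=|eps eps0]; first exact: cvg_cst.
  exists K; split => // m /fK /= ->.
  by rewrite expr0n addr0 sqrtr0.
split; first by split => // m; rewrite lecE /= eqxx f_ge0.
have [b b0 fb] := orbit_integral_bounded.
have hb m : `|h m| <= b.
  have [|_] := fb m (cst 1) (@measurable_cst _ _ _ _ _ _).
    by move=> x; rewrite normr1.
  by under eq_Rintegral do rewrite /= mul1r.
exists (fun m => (h m)%:C%C); split.
  split; first exact: orbit_integral_continuous.
  split=> [x /=|]; first exact: cvg_cst.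
  by exists b => m; rewrite normc_real//=; exact: hb.
move=> g Cg eps eps0.
have b1 : 0 < b + 1 by rewrite ltr_wpDl.
have [_ [_ /(_ (eps / (b + 1)))[|L [cL gL]]]] := Cg; first by rewrite divr_gt0.
have [D cD D0] := orbit_support cL.
(* Any [lam] in the index set above this indicator equals 1 on [D], which carries the integrands of
   all points of [L]. *)
exists \1_D; split.
  split; first by apply: measurable_indic; exact: compact_measurable.
  split=> [x|]; first by rewrite indicE; case: (_ \in _); rewrite /= ?ler01 ?lexx.
  by exists D; split=> // x nDx; rewrite indicE memNset.
move=> lam Blam Dlam m.
have [mlam [lam01 _]] := Blam.
suff main : cabs ((p_lam inv act mu lam (fun m => (f m)%:C%C) m - (h m)%:C%C) * g m) <= eps.
  by split; [rewrite -mulrBl|rewrite -mulrBr mulrC].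
rewrite Normc.normcM.
(* Since [w] has modulus at most 1, the bound [b] for weighted orbit integrals applies to the
   difference with [h], uniformly in [lam] and [m]. *)
pose w x := lam x - 1.
have w1 x : `|w x| <= 1.
  have /andP[l0 l1] := lam01 x.
  by rewrite ler_norml /w; apply/andP; split; lra.
have mw : measurable_fun [set: Borel G] (w : Borel G -> R).
  by apply: measurable_funB => //; exact: measurable_cst.
have pE : p_lam inv act mu lam (fun m => (f m)%:C%C) m - (h m)%:C%C =
    (\int[mu]_x (w x * f (act (inv x) m)))%:C%C.
  have [|ih _] := fb m (cst 1) (@measurable_cst _ _ _ _ _ _).
    by move=> x; rewrite normr1.
  apply/eqP; rewrite eq_complex /= subr0; apply/andP; split; apply/eqP; last first.
    under eq_Rintegral do rewrite mulr0.
    by rewrite Rintegral_cst// mul0r.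
  rewrite /h -RintegralB//.
  - by apply: eq_Rintegral => x _; rewrite /w mulrBl mul1r.
  - exact: (integrable_orbit m Blam f0).
  - by apply: eq_integrable ih => // x _ /=; rewrite mul1r.
have [_ pb] := fb m w mw w1.
rewrite pE normc_real//=.
have [Lm|/gL gm] := pselect (L m).
  suff -> : \int[mu]_x (w x * f (act (inv x) m)) = 0 by rewrite normr0 mul0r ltW.
  rewrite (@eq_Rintegral _ _ _ _ _ (cst 0)) ?Rintegral_cst ?mul0r// => x _.
  have [Dx|nDx] := pselect (D x); last by rewrite D0// mulr0.
  have := Dlam x; rewrite indicE mem_set// /w => lam1.
  have /andP[_ l1] := lam01 x.
  have -> : lam x = 1 by apply/eqP; rewrite eq_le l1.
  by rewrite subrr mul0r.
apply: (@le_trans _ _ (b * (eps / (b + 1)))).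
  apply: ler_pM => //; last exact: ltW.
  exact: le_trans (normr_ge0 _) (normc_ge_Re _).
by rewrite mulrA ler_pdivrMr// mulrDr mulr1 mulrC lerDl ltW.
Qed.

End compact_support.

Lemma proper_space_Cstar : proper_Cstar_action inv act mu.
Proof.
move=> f [cR [cI f0]] eps eps0.
pose e := eps / 2; have e0 : 0 < e by rewrite divr_gt0.
have [K [cK fK]] := f0 e e0.
(* When [u] is dominated by the modulus of [f], this is zero off [K], so it has compact support. *)
pose clip (u : M -> R) m := Num.max (u m - e) 0.
have clip_proper (u : M -> R) : continuous u -> (forall m, `|u m| <= cabs (f m)) ->
    alpha_proper inv act mu (fun m => (clip u m)%:C%C).
  move=> cu uf; apply: (@compact_support_alpha_proper _ K) => //.
  - move=> m; apply: (@continuous_max _ _ (fun m => u m - e) (fun=> 0)).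
      by apply: cvgB; [exact: cu|exact: cvg_cst].
    exact: cvg_cst.
  - by move=> m; rewrite le_max lexx orbT.
  - move=> m /fK fe; apply/max_idPr; rewrite subr_le0.
    exact: le_trans (ler_norm _) (le_trans (uf m) (ltW fe)).
(* At most one of [u] and [- u] exceeds [e], so the difference of their truncations is [u] moved
   towards 0 by at most [e]. *)
have clipE (u : M -> R) m : `|u m - (clip u m - clip (fun m => - u m) m)| <= e.
  rewrite /clip /Num.max; case: ltP => h1; case: ltP => h2; rewrite ler_norml;
    by apply/andP; split; lra.
pose Ref m := complex.Re (f m); pose Imf m := complex.Im (f m).
have ImC m : `|Imf m| <= cabs (f m).
  rewrite /Imf; case: (f m) => a b /=; rewrite -sqrtr_sqr; apply: ler_wsqrtr.
  by rewrite lerDr sqr_ge0.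
(* The errors [e = eps / 2] of the real and imaginary parts add up to [eps]. *)
exists [:: (1, (fun m => (clip Ref m)%:C%C));
  (-1, (fun m => (clip (fun m => - Ref m) m)%:C%C));
  ('i%C, (fun m => (clip Imf m)%:C%C));
  (- 'i%C, (fun m => (clip (fun m => - Imf m) m)%:C%C))].
have cN (u : M -> R) : continuous u -> continuous (fun m => - u m).
  by move=> cu m; apply: cvgN; exact: cu.
split=> [p|m].
  rewrite !inE => /or4P[] /eqP -> /=; apply: clip_proper => //; try exact: cN;
    by move=> m; rewrite ?normrN//; exact: normc_ge_Re.
rewrite !big_cons big_nil /=.
set z := (X in cabs X).
have zR : complex.Re z = Ref m - (clip Ref m - clip (fun m => - Ref m) m).
  rewrite /z /Ref; case: (f m) => a b /=; ring.
have zI : complex.Im z = Imf m - (clip Imf m - clip (fun m => - Imf m) m).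
  rewrite /z /Imf; case: (f m) => a b /=; ring.
rewrite (le_trans (normc_le_ReIm z))// zR zI [eps]splitr lerD//; exact: clipE.
Qed.

End proper_space.

End action.

Theorem theorem4p7 (R : realType) (G : ptopologicalType) (M : topologicalType)
    (mul : G -> G -> G) (inv : G -> G) (one : G)
    (mu : {measure set (Borel G) -> \bar R}) (act : G -> M -> M) :
  is_lc_group mul inv one ->
  is_left_Haar mul mu ->
  hausdorff_space M -> locally_compact [set: M] ->
  is_cont_action mul one act ->
  (proper_Cstar_action inv act mu <-> proper_space_action act).
Proof.
move=> hG hmu hM lM hact; split.
- exact: (proper_Cstar_space hG hmu hM lM hact).
- exact: (proper_space_Cstar hG hmu lM hact).
Qed.
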